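(* Let $G$ be a finite abelian group and let $p\in[1,\infty)$. Then $M(F_0^p(G))$ is isometrically isomorphic, as a Banach algebra, to $(\ell_0^1(G),|||\cdot|||_p)$ (with convolution product), where $$|||a|||_p=\|L_a\|_{F_0^p(G)\to F_0^p(G)}=\sup\{\|ab\|_{F^p(G)} : b\in\ell_0^1(G),\ \|b\|_{F^p(G)}=1\}$$ and $L_a$ denotes left multiplication by $a$, $L_a(b)=ab$.
   Context: For a finite group $G$: $\ell^1(G)$ is the algebra of functions $a\colon G\to\mathbb{C}$ with convolution product $(ab)(g)=\sum_{h\in G}a(h)b(h^{-1}g)$; $\ell_0^1(G)=\{a\in\ell^1(G):\sum_{g\in G}a(g)=0\}$. For $p\in[1,\infty)$, $\lambda_p\colon\ell^1(G)\to\mathcal{L}(\ell^p(G))$ is $\lambda_p(a)b=ab$ (convolution), and $\|a\|_{F^p(G)}=\|\lambda_p(a)\|_{\mathcal{L}(\ell^p(G))}$ (for finite $G$ this coincides with the norm of the full group $L^p$-operator algebra). $F_0^p(G)$ is $\ell_0^1(G)$ with the norm $\|\cdot\|_{F^p(G)}$, equivalently $\lambda_p(\ell_0^1(G))\subseteq\mathcal{L}(\ell^p(G))$. Multiplier algebra of a Banach algebra $A$: $M(A)$ is the set of pairs $(L,R)$ with $L,R\in\mathcal{L}(A)$ (bounded linear maps) such that $L(ab)=L(a)b$, $R(ab)=aR(b)$ and $aL(b)=R(a)b$ for all $a,b\in A$, with product $(L,R)(L',R')=(LL',R'R)$ and norm $\|(L,R)\|=\max\{\|L\|,\|R\|\}$.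 *)

(* Defs.v *)
From HB Require Import structures.
From mathcomp Require Import all_boot all_order all_algebra all_fingroup.
From mathcomp Require Import complex ring lra.
From mathcomp Require Import all_classical all_reals all_analysis.

Set Implicit Arguments.
Unset Strict Implicit.
Unset Printing Implicit Defensive.

Import Order.TTheory GRing.Theory Num.Theory.
Import numFieldNormedType.Exports.
Import Normc.

Local Open Scope classical_set_scope.
Local Open Scope ring_scope.
Local Open Scope complex_scope.

HB.mixin Record isBanachAlgebra (R : realType) A
    & CompleteNormedModule R[i] A := {
  bmul : A -> A -> A;
  bmulA : associative bmul;
  bmul_linearl : forall b : A, linear (bmul^~ b);
  bmul_linearr : forall a : A, linear (bmul a);
  bmul_norm : forall a b : A, `|bmul a b| <= `|a| * `|b|
}.

#[short(type="banachAlgType")]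
HB.structure Definition BanachAlgebra (R : realType) :=
  {A of CompleteNormedModule R[i] A & isBanachAlgebra R A}.

Notation "a ** b" := (bmul a b) (at level 40, left associativity).

Definition isometrically_isomorphic (R : realType) (A B : banachAlgType R) :=
  exists f : A -> B,
    [/\ linear f, bijective f, forall a b, f (a ** b) = f a ** f b
      & forall a, `|f a| = `|a|].

(* Norms of R[i]-modules are R[i]-valued in the library; rnorm is the same
   norm (see rnormE) seen as an element of R, where suprema are available. *)
Definition rnorm (R : realType) (V : normedModType R[i]) (v : V) : R :=
  complex.Re `|v|.

Definition opnorm (R : realType) (V W : normedModType R[i]) (T : V -> W) : R :=
  sup [set rnorm (T v) | v in [set v | rnorm v <= 1]].

Definition bounded_op (R : realType) (V W : normedModType R[i]) (T : V -> W) :=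
  linear T /\ exists M : R, forall v, rnorm (T v) <= M * rnorm v.

Section OperatorNorm.
Variable R : realType.
Implicit Types U V W : normedModType R[i].

Lemma normcE (z : R[i]) : `|z| = (normc z)%:C.
Proof. by case: z. Qed.

Lemma normc_real (x : R) : 0 <= x -> normc x%:C = x.
Proof. by move=> x0; rewrite /normc/= expr0n/= addr0 sqrtr_sqr ger0_norm. Qed.

Lemma normc_ge0 (z : R[i]) : 0 <= normc z.
Proof. by case: z => a b; rewrite /normc sqrtr_ge0. Qed.

Lemma rnormE V (v : V) : (rnorm v)%:C = `|v|.
Proof.
have := normr_ge0 v; rewrite /rnorm; case: (`|v|) => a b.
by rewrite lecE/= => /andP[/eqP -> _].
Qed.

Lemma rnorm_ge0 V (v : V) : 0 <= rnorm v.
Proof. by rewrite -lecR rnormE normr_ge0. Qed.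

Lemma rnormD V (v w : V) : rnorm (v + w) <= rnorm v + rnorm w.
Proof. by rewrite -lecR rmorphD/= !rnormE ler_normD. Qed.

Lemma rnormZ V (c : R[i]) (v : V) : rnorm (c *: v) = normc c * rnorm v.
Proof. by apply: (@complexI R); rewrite rmorphM/= !rnormE normrZ normcE. Qed.

Lemma rnormB V (v w : V) : rnorm (v - w) = rnorm (w - v).
Proof. by apply: (@complexI R); rewrite !rnormE distrC. Qed.

Lemma rnorm0 V : rnorm (0 : V) = 0.
Proof. by apply: (@complexI R); rewrite rnormE normr0. Qed.

Lemma rnorm0_eq0 V (v : V) : rnorm v = 0 -> v = 0.
Proof. by move=> h; apply/eqP; rewrite -normr_eq0 -rnormE h. Qed.

Lemma rnorm_sum V (I : Type) (r : seq I) (F : I -> V) :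
  rnorm (\sum_(i <- r) F i) <= \sum_(i <- r) rnorm (F i).
Proof.
elim/big_ind2: _ => [|x1 x2 y1 y2 h1 h2|//]; first by rewrite rnorm0.
by rewrite (le_trans (rnormD _ _))// lerD.
Qed.

Lemma small_eq0 V (v : V) (k : R) :
  (forall e : R, 0 < e -> rnorm v <= e * k) -> v = 0.
Proof.
move=> h; apply: rnorm0_eq0; apply/eqP; rewrite eq_le rnorm_ge0 andbT.
have k0 : 0 <= k by rewrite -[k]mul1r (le_trans (rnorm_ge0 v))// h.
apply/ler_addgt0Pr => e e0; rewrite add0r.
have k1 : 0 < k + 1 by rewrite ltr_wpDl.
apply: (le_trans (h (e / (k + 1)) _)); first by rewrite divr_gt0.
by rewrite -mulrA ler_piMr ?(ltW e0)// mulrC ler_pdivrMr// mul1r lerDl.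
Qed.

Lemma linearop0 (V W : lmodType R[i]) (T : V -> W) :
  linear T -> T 0 = 0.
Proof.
move=> lT; have := lT 1 0 0; rewrite scaler0 addr0 scale1r => h.
by apply: (@addrI _ (T 0)); rewrite addr0 -h.
Qed.

Lemma linearopZ (V W : lmodType R[i]) (T : V -> W) :
  linear T -> forall c v, T (c *: v) = c *: T v.
Proof.
by move=> lT c v; rewrite -[c *: v]addr0 lT (linearop0 lT) addr0.
Qed.

Lemma linearopD (V W : lmodType R[i]) (T : V -> W) :
  linear T -> forall u v, T (u + v) = T u + T v.
Proof. by move=> lT u v; rewrite -[u in LHS]scale1r lT scale1r. Qed.

Lemma linearopB (V W : lmodType R[i]) (T : V -> W) :
  linear T -> forall u v, T (u - v) = T u - T v.
Proof.
by move=> lT u v; rewrite linearopD// -scaleN1r linearopZ// scaleN1r.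
Qed.

Lemma opnorm_ub V W (T : V -> W) : bounded_op T ->
  forall v, rnorm v <= 1 -> rnorm (T v) <= opnorm T.
Proof.
move=> [lT [M hM]] v v1; apply: sup_upper_bound; last by exists v.
split; first by exists (rnorm (T v)); exists v.
exists `|M| => _ [w w1 <-]; apply: (le_trans (hM w)).
rewrite (le_trans (ler_norm _))// normrM ler_piMr//.
by rewrite ger0_norm ?rnorm_ge0.
Qed.

Lemma opnorm_ge0 V W (T : V -> W) : bounded_op T -> 0 <= opnorm T.
Proof.
move=> bT; have := @opnorm_ub _ _ _ bT 0; rewrite rnorm0 ler01 => /(_ isT).
by apply: le_trans; exact: rnorm_ge0.
Qed.

Lemma opnorm_le V W (T : V -> W) : bounded_op T ->
  forall v, rnorm (T v) <= opnorm T * rnorm v.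
Proof.
move=> bT v; have [v0|v0] := eqVneq (rnorm v) 0.
  by rewrite v0 mulr0 (rnorm0_eq0 v0) (linearop0 bT.1) rnorm0.
have vp : 0 < rnorm v by rewrite lt_def v0 rnorm_ge0.
rewrite -ler_pdivrMr// mulrC.
have nI : normc ((rnorm v)^-1)%:C = (rnorm v)^-1.
  by rewrite normc_real// invr_ge0 ltW.
rewrite -nI -rnormZ -(linearopZ bT.1) opnorm_ub// rnormZ nI mulVf//.
Qed.

Lemma opnorm_lub V W (T : V -> W) (M : R) :
  0 <= M -> (forall v, rnorm (T v) <= M * rnorm v) -> opnorm T <= M.
Proof.
move=> M0 h; apply: ge_sup.
  by exists (rnorm (T 0)), 0 => //=; rewrite rnorm0.
by move=> _ [v v1 <-]; rewrite (le_trans (h v))// ler_piMr.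
Qed.

Lemma opnormD V W (S T : V -> W) : bounded_op S -> bounded_op T ->
  opnorm (S \+ T) <= opnorm S + opnorm T.
Proof.
move=> bS bT; apply: opnorm_lub => [|v]; first by rewrite addr_ge0 ?opnorm_ge0.
by rewrite (le_trans (rnormD _ _))// mulrDl lerD// opnorm_le.
Qed.

Lemma bounded_opL V W (c : R[i]) (S T : V -> W) :
  bounded_op S -> bounded_op T -> bounded_op (fun v => c *: S v + T v).
Proof.
move=> [lS [M hM]] [lT [N hN]]; split=> [d u v|].
  by rewrite lS lT !scalerDr !scalerA [c * d]mulrC addrACA.
exists (normc c * M + N) => v; rewrite (le_trans (rnormD _ _))//.
by rewrite mulrDl rnormZ -mulrA lerD// ler_wpM2l ?normc_ge0.
Qed.

Lemma bounded_opZ V W (c : R[i]) (T : V -> W) :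
  bounded_op T -> bounded_op (fun v => c *: T v).
Proof.
move=> [lT [M hM]]; split=> [d u v|].
  by rewrite lT scalerDr !scalerA [c * d]mulrC.
by exists (normc c * M) => v; rewrite rnormZ -mulrA ler_wpM2l ?normc_ge0.
Qed.

Lemma bounded_op_comp U V W (S : V -> W) (T : U -> V) :
  bounded_op S -> bounded_op T -> bounded_op (S \o T).
Proof.
move=> bS bT; split=> [c u v|]; first by rewrite /= bT.1 bS.1.
exists (opnorm S * opnorm T) => v /=; rewrite (le_trans (opnorm_le bS _))//.
by rewrite -mulrA ler_wpM2l ?opnorm_ge0// opnorm_le.
Qed.

Lemma opnorm_comp U V W (S : V -> W) (T : U -> V) :
  bounded_op S -> bounded_op T -> opnorm (S \o T) <= opnorm S * opnorm T.
Proof.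
move=> bS bT; apply: opnorm_lub => [|v]; first by rewrite mulr_ge0// opnorm_ge0.
rewrite (le_trans (opnorm_le bS _))//.
by rewrite -mulrA ler_wpM2l ?opnorm_ge0// opnorm_le.
Qed.

Lemma opnormZ V W (c : R[i]) (T : V -> W) : bounded_op T ->
  opnorm (fun v => c *: T v) = normc c * opnorm T.
Proof.
move=> bT; apply/eqP; rewrite eq_le; apply/andP; split.
  apply: opnorm_lub => [|v]; first by rewrite mulr_ge0 ?normc_ge0 ?opnorm_ge0.
  by rewrite rnormZ -mulrA ler_wpM2l ?normc_ge0// opnorm_le.
have [->|c0] := eqVneq c 0.
  by rewrite normc0 mul0r opnorm_ge0//; exact: bounded_opZ.
have nc : 0 < normc c.
  by rewrite lt_def normc_ge0 andbT; apply: contra c0 => /eqP/eq0_normc ->.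
rewrite mulrC -ler_pdivlMr//; apply: opnorm_lub => [|v].
  by rewrite divr_ge0 ?normc_ge0// opnorm_ge0//; exact: bounded_opZ.
rewrite mulrAC ler_pdivlMr// mulrC -rnormZ.
exact: (opnorm_le (bounded_opZ c bT)).
Qed.

Lemma cauchy_rnorm V (F : set_system V) {FF : ProperFilter F} :
  (forall e : R, 0 < e -> exists v, F [set w | rnorm (v - w) < e]) -> cauchy F.
Proof.
move=> h; apply: cauchy_exP => e; rewrite ltcE/= => /andP[/eqP e0 e_gt0].
have [v Fv] := h _ e_gt0; exists v; apply: filterS Fv => w /= hw.
by rewrite -ball_normE/= -rnormE ltcE/= e0 hw eqxx.
Qed.

Lemma rnorm_cauchy V (F : set_system V) {FF : ProperFilter F} : cauchy F ->
  forall e : R, 0 < e -> exists v, F [set w | rnorm (v - w) < e].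
Proof.
move=> /cauchyP h e e0; have [|v Fv] := h e%:C; first by rewrite ltcR.
by exists v; apply: filterS Fv => w; rewrite -ball_normE/= -rnormE ltcR.
Qed.

Lemma cvg_rnorm V (F : set_system V) {FF : Filter F} (v : V) :
  (forall e : R, 0 < e -> F [set w | rnorm (v - w) < e]) -> F --> v.
Proof.
move=> h; apply/cvgrPdist_lt => e; rewrite ltcE/= => /andP[/eqP e0 e_gt0].
by apply: filterS (h _ e_gt0) => w /= hw; rewrite -rnormE ltcE/= e0 eqxx hw.
Qed.

Lemma rnorm_cvg V (F : set_system V) {FF : Filter F} (v : V) :
  F --> v -> forall e : R, 0 < e -> F [set w | rnorm (v - w) < e].
Proof.
move=> /cvgrPdist_lt h e e0; have e0C : 0 < e%:C by rewrite ltcR.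
by apply: filterS (h _ e0C) => w; rewrite -rnormE ltcR.
Qed.

End OperatorNorm.

Definition is_multiplier (R : realType) (A : banachAlgType R)
    (m : (A -> A) * (A -> A)) : Prop :=
  [/\ bounded_op m.1, bounded_op m.2,
      forall a b, m.1 (a ** b) = m.1 a ** b,
      forall a b, m.2 (a ** b) = a ** m.2 b
    & forall a b, a ** m.1 b = m.2 a ** b].

Definition multiplier_pred (R : realType) (A : banachAlgType R)
  : {pred (A -> A) * (A -> A)} := fun m => `[< is_multiplier m >].

Record multiplier (R : realType) (A : banachAlgType R) := Multiplier {
  mult_pair : (A -> A) * (A -> A);
  _ : mult_pair \in @multiplier_pred R A }.

Definition multL (R : realType) (A : banachAlgType R) (m : multiplier A) :=
  (mult_pair m).1.
Definition multR (R : realType) (A : banachAlgType R) (m : multiplier A) :=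
  (mult_pair m).2.

Section MultiplierAlgebra.
Variables (R : realType) (A : banachAlgType R).
Implicit Types m : multiplier A.

Lemma bmulZl c (a b : A) : (c *: a) ** b = c *: (a ** b).
Proof. exact: (linearopZ (bmul_linearl b)). Qed.
Lemma bmulZr c (a b : A) : a ** (c *: b) = c *: (a ** b).
Proof. exact: (linearopZ (bmul_linearr a)). Qed.
Lemma bmulDl (a b c : A) : (a + b) ** c = a ** c + b ** c.
Proof. exact: (linearopD (bmul_linearl c)). Qed.
Lemma bmulDr (a b c : A) : a ** (b + c) = a ** b + a ** c.
Proof. exact: (linearopD (bmul_linearr a)). Qed.
Lemma bmulBl (a b c : A) : (a - b) ** c = a ** c - b ** c.
Proof. exact: (linearopB (bmul_linearl c)). Qed.
Lemma bmulBr (a b c : A) : a ** (b - c) = a ** b - a ** c.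
Proof. exact: (linearopB (bmul_linearr a)). Qed.
Lemma bmul_rnorm (a b : A) : rnorm (a ** b) <= rnorm a * rnorm b.
Proof. by rewrite -lecR rmorphM/= !rnormE bmul_norm. Qed.

HB.instance Definition _ := [isSub for @mult_pair R A].
HB.instance Definition _ := [Choice of multiplier A by <:].

Lemma multiplierP m : is_multiplier (mult_pair m).
Proof. by case: m => m /= /asboolP. Qed.

Lemma multL_bounded m : bounded_op (multL m).
Proof. by case: (multiplierP m). Qed.
Lemma multR_bounded m : bounded_op (multR m).
Proof. by case: (multiplierP m). Qed.

Lemma multiplier_ext m m' :
  (forall v, multL m v = multL m' v) -> (forall v, multR m v = multR m' v) ->
  m = m'.
Proof.
move=> hL hR; apply: val_inj; rewrite /= /multL/multR in hL hR *.
by move/funext : hL; move/funext : hR; case: (mult_pair m) => ? ?;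
  case: (mult_pair m') => ? ? /= -> ->.
Qed.

Lemma multiplier_submod : submod_closed (@multiplier_pred R A).
Proof.
have H0 : linear (fun _ : A => 0 : A) by move=> c u v; rewrite scaler0 addr0.
have B0 : bounded_op (fun _ : A => 0 : A).
  by split=> //; exists 0 => v; rewrite mul0r rnorm0.
split.
  apply/asboolP; split=> //= a b.
  - by rewrite (linearop0 (bmul_linearl b)).
  - by rewrite (linearop0 (bmul_linearr a)).
  - by rewrite (linearop0 (bmul_linearr a)) (linearop0 (bmul_linearl b)).
move=> c u v /asboolP[bu1 bu2 u1 u2 u3] /asboolP[bv1 bv2 v1 v2 v3].
apply/asboolP; split=> [||a b|a b|a b].
- exact: (bounded_opL c bu1 bv1).
- exact: (bounded_opL c bu2 bv2).
- rewrite -[LHS]/(c *: u.1 (a ** b) + v.1 (a ** b)).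
  by rewrite -[RHS]/((c *: u.1 a + v.1 a) ** b) u1 v1 bmulDl bmulZl.
- rewrite -[LHS]/(c *: u.2 (a ** b) + v.2 (a ** b)).
  by rewrite -[RHS]/(a ** (c *: u.2 b + v.2 b)) u2 v2 bmulDr bmulZr.
- rewrite -[LHS]/(a ** (c *: u.1 b + v.1 b)) -[RHS]/((c *: u.2 a + v.2 a) ** b).
  by rewrite bmulDr bmulDl bmulZr bmulZl u3 v3.
Qed.

HB.instance Definition _ :=
  GRing.isSubmodClosed.Build _ _ (@multiplier_pred R A) multiplier_submod.
HB.instance Definition _ := [SubChoice_isSubLmodule of multiplier A by <:].

Lemma multLD m m' : multL (m + m') = multL m \+ multL m'. Proof. by []. Qed.
Lemma multRD m m' : multR (m + m') = multR m \+ multR m'. Proof. by []. Qed.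
Lemma multLZ c m : multL (c *: m) = fun v => c *: multL m v. Proof. by []. Qed.
Lemma multRZ c m : multR (c *: m) = fun v => c *: multR m v. Proof. by []. Qed.
Lemma multLB m m' v : multL (m - m') v = multL m v - multL m' v.
Proof. by []. Qed.
Lemma multRB m m' v : multR (m - m') v = multR m v - multR m' v.
Proof. by []. Qed.

Definition mult_norm (m : multiplier A) : R :=
  Order.max (opnorm (multL m)) (opnorm (multR m)).

Lemma mult_norm_le m (M : R) : 0 <= M ->
  (forall v, rnorm (multL m v) <= M * rnorm v) ->
  (forall v, rnorm (multR m v) <= M * rnorm v) -> mult_norm m <= M.
Proof. by move=> M0 hL hR; rewrite ge_max !opnorm_lub. Qed.

Lemma mult_norm_ge0 m : 0 <= mult_norm m.
Proof. by rewrite le_max opnorm_ge0//; exact: multL_bounded. Qed.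

Lemma multL_le m v : rnorm (multL m v) <= mult_norm m * rnorm v.
Proof.
rewrite (le_trans (opnorm_le (multL_bounded m) v))// ler_wpM2r ?rnorm_ge0//.
by rewrite le_max lexx.
Qed.

Lemma multR_le m v : rnorm (multR m v) <= mult_norm m * rnorm v.
Proof.
rewrite (le_trans (opnorm_le (multR_bounded m) v))// ler_wpM2r ?rnorm_ge0//.
by rewrite le_max lexx orbT.
Qed.

Lemma mult_normD m m' :
  (mult_norm (m + m'))%:C <= (mult_norm m)%:C + (mult_norm m')%:C.
Proof.
rewrite -rmorphD/= lecR; apply: mult_norm_le => [|v|v].
- by rewrite addr_ge0 ?mult_norm_ge0.
- by rewrite multLD (le_trans (rnormD _ _))// mulrDl lerD// multL_le.
- by rewrite multRD (le_trans (rnormD _ _))// mulrDl lerD// multR_le.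
Qed.

Lemma mult_normZ c m : (mult_norm (c *: m))%:C = `|c| * (mult_norm m)%:C.
Proof.
rewrite normcE -rmorphM/=; congr (_%:C).
rewrite /mult_norm multLZ multRZ !opnormZ ?maxr_pMr ?normc_ge0//.
- exact: multR_bounded.
- exact: multL_bounded.
Qed.

Lemma mult_norm0_eq0 m : (mult_norm m)%:C = 0 -> m = 0.
Proof.
move=> [m0]; apply: multiplier_ext => v; apply: rnorm0_eq0; apply/eqP;
  rewrite eq_le rnorm_ge0 andbT.
- by have := multL_le m v; rewrite m0 mul0r.
- by have := multR_le m v; rewrite m0 mul0r.
Qed.

HB.instance Definition _ := Lmodule_isNormed.Build R[i] (multiplier A)
  mult_normD mult_normZ mult_norm0_eq0.

Lemma rnorm_mult m : rnorm m = mult_norm m.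
Proof. by []. Qed.

Lemma multiplier_complete (F : set_system (multiplier A)) :
  ProperFilter F -> cauchy F -> cvg F.
Proof.
move=> FF Fc; have Fe := @rnorm_cauchy _ _ F FF Fc.
have lim_op (op : multiplier A -> A -> A) :
    (forall m m' v, rnorm (op m v - op m' v) <= rnorm (m - m') * rnorm v) ->
    exists L : A -> A, forall m (e : R), F [set m' | rnorm (m - m') < e] ->
      forall v, rnorm (op m v - L v) <= e * rnorm v.
  move=> hop.
  have pt v : exists l : A, op^~ v @ F --> l.
    suff : cvg (op^~ v @ F) by move=> h; exists (lim (op^~ v @ F)).
    apply: cauchy_cvg; apply: cauchy_rnorm => e e0.
    have d0 : 0 < e / (rnorm v + 1).
      by rewrite divr_gt0// ltr_wpDl ?rnorm_ge0.
    have [m Fm] := Fe _ d0; exists (op m v).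
    suff : F [set m' | rnorm (op m v - op m' v) < e] by [].
    apply: filterS Fm => m' /= mm'.
    apply: (le_lt_trans (hop _ _ _)); have [v0|v0] := eqVneq (rnorm v) 0.
      by rewrite v0 mulr0.
    have vp : 0 < rnorm v by rewrite lt_def v0 rnorm_ge0.
    rewrite -ltr_pdivlMr//; apply: (lt_le_trans mm').
    by rewrite ler_pM2l// lef_pV2 ?posrE ?addr_gt0// lerDl.
  have [L hL] := choice pt; exists L => m e Fm v.
  apply/ler_addgt0Pr => d d0.
  have Fd : F [set m' | rnorm (L v - op m' v) < d].
    exact: (@rnorm_cvg _ _ _ _ (L v) (hL v) _ d0).
  have [m' [/= m1 m2]] := filter_ex (filterI Fd Fm).
  have -> : op m v - L v = (op m v - op m' v) + (op m' v - L v).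
    by rewrite addrA subrK.
  rewrite (le_trans (rnormD _ _))// lerD//; last by rewrite rnormB ltW.
  by rewrite (le_trans (hop _ _ _))// ler_wpM2r ?rnorm_ge0// ltW.
have [L hL] := lim_op (@multL R A) (fun m m' v => multL_le (m - m') v).
have [S hS] := lim_op (@multR R A) (fun m m' v => multR_le (m - m') v).
have lin_lim (op : multiplier A -> A -> A) (T : A -> A) :
    (forall m, bounded_op (op m)) ->
    (forall m (e : R), F [set m' | rnorm (m - m') < e] ->
      forall v, rnorm (op m v - T v) <= e * rnorm v) -> bounded_op T.
  move=> bop hT; split=> [c u v|].
    apply/eqP; rewrite -subr_eq0; apply/eqP.
    apply: (@small_eq0 _ _ _
      (rnorm (c *: u + v) + (normc c * rnorm u + rnorm v))) => e e0.
    have [m /hT hm] := Fe _ e0.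
    have -> : T (c *: u + v) - (c *: T u + T v) =
        (T (c *: u + v) - op m (c *: u + v)) +
        (c *: (op m u - T u) + (op m v - T v)).
      rewrite (bop m).1 scalerBr opprD addrA.
      rewrite [_ + (op m v - _)]addrACA -opprD.
      rewrite [X in _ = X]addrA -[X in _ = X + _]addrA addNr addr0.
      by rewrite opprD addrA.
    rewrite mulrDr (le_trans (rnormD _ _))// lerD//; first by rewrite rnormB hm.
    rewrite (le_trans (rnormD _ _))// mulrDr lerD// rnormZ mulrCA.
    by rewrite ler_wpM2l ?normc_ge0.
  have [m /hT hm] := Fe 1 ltr01; exists (opnorm (op m) + 1) => v.
  have -> : T v = op m v + (T v - op m v) by rewrite addrC subrK.
  rewrite (le_trans (rnormD _ _))// mulrDl lerD ?opnorm_le//.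
  by rewrite rnormB hm.
have mP : (L, S) \in @multiplier_pred R A.
  apply/asboolP; split=> /= [||a b|a b|a b].
  - exact: (lin_lim _ _ multL_bounded hL).
  - exact: (lin_lim _ _ multR_bounded hS).
  - apply/eqP; rewrite -subr_eq0; apply/eqP.
    apply: (@small_eq0 _ _ _ (rnorm (a ** b) + rnorm a * rnorm b)) => e e0.
    have [m /hL hm] := Fe _ e0; have [_ _ mL _ _] := multiplierP m.
    have -> : L (a ** b) - L a ** b =
        (L (a ** b) - multL m (a ** b)) + (multL m a - L a) ** b.
      by rewrite bmulBl -[multL m a ** b]mL addrA subrK.
    rewrite mulrDr (le_trans (rnormD _ _))// lerD//; first by rewrite rnormB hm.
    by rewrite (le_trans (bmul_rnorm _ _))// mulrA ler_wpM2r ?rnorm_ge0.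
  - apply/eqP; rewrite -subr_eq0; apply/eqP.
    apply: (@small_eq0 _ _ _ (rnorm (a ** b) + rnorm b * rnorm a)) => e e0.
    have [m /hS hm] := Fe _ e0; have [_ _ _ mR _] := multiplierP m.
    have -> : S (a ** b) - a ** S b =
        (S (a ** b) - multR m (a ** b)) + a ** (multR m b - S b).
      by rewrite bmulBr -[a ** multR m b]mR addrA subrK.
    rewrite mulrDr (le_trans (rnormD _ _))// lerD//; first by rewrite rnormB hm.
    rewrite (le_trans (bmul_rnorm _ _))// mulrA mulrC.
    by rewrite ler_wpM2r ?rnorm_ge0.
  - apply/eqP; rewrite -subr_eq0; apply/eqP.
    apply: (@small_eq0 _ _ _ (rnorm b * rnorm a + rnorm a * rnorm b)) => e e0.
    have [m Fm] := Fe _ e0; have [_ _ _ _ mLR] := multiplierP m.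
    have -> : a ** L b - S a ** b =
        a ** (L b - multL m b) + (multR m a - S a) ** b.
      by rewrite bmulBr bmulBl -[multR m a ** b]mLR addrA subrK.
    rewrite mulrDr (le_trans (rnormD _ _))// lerD//.
      rewrite (le_trans (bmul_rnorm _ _))// mulrA mulrC.
      by rewrite ler_wpM2r ?rnorm_ge0// rnormB hL.
    rewrite (le_trans (bmul_rnorm _ _))// mulrA.
    by rewrite ler_wpM2r ?rnorm_ge0// hS.
apply/cvg_ex; exists (Multiplier mP); apply: cvg_rnorm => e e0.
have [|m Fm] := Fe (e / 2); first by rewrite divr_gt0.
apply: filterS (Fm) => m' /= mm'; rewrite [e]splitr.
have -> : Multiplier mP - m' = (Multiplier mP - m) + (m - m').
  by rewrite addrA subrK.
rewrite (le_lt_trans (rnormD _ _))// ler_ltD// rnormB rnorm_mult.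
apply: mult_norm_le => [|v|v]; first by rewrite ltW// divr_gt0.
- by rewrite multLB; exact: hL.
- by rewrite multRB; exact: hS.
Qed.

HB.instance Definition _ :=
  Uniform_isComplete.Build (multiplier A) multiplier_complete.

Lemma mult_mul_subproof m m' :
  (multL m \o multL m', multR m' \o multR m) \in @multiplier_pred R A.
Proof.
have [L1 R1 hL1 hR1 hLR1] := multiplierP m.
have [L2 R2 hL2 hR2 hLR2] := multiplierP m'.
apply/asboolP; split=> /= [||a b|a b|a b].
- exact: bounded_op_comp.
- exact: bounded_op_comp.
- by rewrite /multL hL2 hL1.
- by rewrite /multR hR1 hR2.
- by rewrite /multL /multR hLR1 hLR2.
Qed.

(* (L, R) (L', R') = (L L', R' R): the right components compose backwards. *)
Definition mult_mul m m' := Multiplier (mult_mul_subproof m m').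

Lemma mult_mulA : associative mult_mul.
Proof. by move=> m1 m2 m3; apply: multiplier_ext. Qed.

Lemma mult_mul_linearl m : linear (mult_mul^~ m).
Proof.
move=> c u v; apply: multiplier_ext => // w.
exact: (multR_bounded m).1.
Qed.

Lemma mult_mul_linearr m : linear (mult_mul m).
Proof.
move=> c u v; apply: multiplier_ext => // w.
exact: (multL_bounded m).1.
Qed.

Lemma mult_mul_norm m m' : `|mult_mul m m'| <= `|m| * `|m'|.
Proof.
rewrite -!rnormE -rmorphM/= lecR !rnorm_mult.
apply: mult_norm_le => [|v|v]; first by rewrite mulr_ge0 ?mult_norm_ge0.
- rewrite (le_trans (multL_le m _))// -mulrA ler_wpM2l ?mult_norm_ge0//.
  exact: multL_le.
- rewrite (le_trans (multR_le m' _))// [mult_norm m * _]mulrC -mulrA.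
  by rewrite ler_wpM2l ?mult_norm_ge0//; exact: multR_le.
Qed.

HB.instance Definition _ := isBanachAlgebra.Build R (multiplier A)
  mult_mulA mult_mul_linearl mult_mul_linearr mult_mul_norm.

End MultiplierAlgebra.

Section FiniteDimensionalCompleteness.
Variable R : realType.

Lemma normcD (x y : R[i]) : normc (x + y) <= normc x + normc y.
Proof. by rewrite -lecR rmorphD/= -!normcE ler_normD. Qed.

Lemma normcB (x y : R[i]) : normc (x - y) = normc (y - x).
Proof. by apply: (@complexI R); rewrite -!normcE distrC. Qed.

Lemma normc_sum (I : finType) (F : I -> R[i]) :
  normc (\sum_i F i) <= \sum_i normc (F i).
Proof.
by rewrite -lecR rmorph_sum/= -normcE (le_trans (ler_norm_sum _ _ _)).
Qed.

Lemma normc_Re (z : R[i]) : `|complex.Re z| <= normc z.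
Proof.
by case: z => a b /=; rewrite -sqrtr_sqr ler_wsqrtr// lerDl sqr_ge0.
Qed.

Lemma normc_Im (z : R[i]) : `|complex.Im z| <= normc z.
Proof.
by case: z => a b /=; rewrite -sqrtr_sqr ler_wsqrtr// lerDr sqr_ge0.
Qed.

Lemma normc_ReIm (z : R[i]) : normc z <= `|complex.Re z| + `|complex.Im z|.
Proof.
case: z => a b /=.
rewrite -[leRHS]ger0_norm ?addr_ge0// -sqrtr_sqr ler_wsqrtr//.
rewrite sqrrD !real_normK ?num_real// -addrA lerD// lerDr.
by rewrite mulrn_wge0// mulr_ge0.
Qed.

Lemma real_cauchy (T : Type) (F : set_system T) {FF : ProperFilter F}
    (f : T -> R) :
  (forall e : R, 0 < e -> exists z, F [set t | `|z - f t| < e]) ->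
  exists l, forall e : R, 0 < e -> F [set t | `|l - f t| < e].
Proof.
move=> h; have : cvg (f @ F).
  apply: cauchy_cvg; apply: cauchy_exP => e e0.
  by have [z Fz] := h _ e0; exists z.
move=> /cvgrPdist_lt hl; exists (lim (f @ F)) => e e0.
exact: hl.
Qed.

Lemma complex_cauchy (T : Type) (F : set_system T) {FF : ProperFilter F}
    (f : T -> R[i]) :
  (forall e : R, 0 < e -> exists z, F [set t | normc (z - f t) < e]) ->
  exists l, forall e : R, 0 < e -> F [set t | normc (l - f t) < e].
Proof.
move=> h.
have [x hx] : exists l, forall e : R, 0 < e ->
    F [set t | `|l - complex.Re (f t)| < e].
  apply: real_cauchy => e e0; have [z Fz] := h _ e0; exists (complex.Re z).
  apply: filterS Fz => t /= ht; apply: le_lt_trans ht.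
  by apply: le_trans (normc_Re _); case: z (f t) => ? ? [].
have [y hy] : exists l, forall e : R, 0 < e ->
    F [set t | `|l - complex.Im (f t)| < e].
  apply: real_cauchy => e e0; have [z Fz] := h _ e0; exists (complex.Im z).
  apply: filterS Fz => t /= ht; apply: le_lt_trans ht.
  by apply: le_trans (normc_Im _); case: z (f t) => ? ? [].
exists (Complex x y) => e e0; have e2 : 0 < e / 2 by rewrite divr_gt0.
apply: filterS (filterI (hx _ e2) (hy _ e2)) => t /= [h1 h2].
rewrite (le_lt_trans (normc_ReIm _))// [e]splitr.
by case: (f t) h1 h2 => a b /= h1 h2; exact: ltrD.
Qed.

Lemma coord_complete (I : finType) (V : normedModType R[i])
    (c : I -> V -> R[i]) (C D : R) :
  (forall i u v, c i (u - v) = c i u - c i v) ->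
  (forall i v, normc (c i v) <= C * rnorm v) ->
  (forall v, rnorm v <= D * \sum_i normc (c i v)) ->
  (forall x : I -> R[i],
    (forall e : R, 0 < e -> exists v, forall i, normc (x i - c i v) < e) ->
    exists v, forall i, c i v = x i) ->
  forall F : set_system V, ProperFilter F -> cauchy F -> cvg F.
Proof.
move=> cB cC cD cl F FF Fc; have Fe := @rnorm_cauchy _ _ F FF Fc.
have C1 : 0 < `|C| + 1 by rewrite ltr_wpDl.
have pt i : exists l, forall e : R, 0 < e -> F [set v | normc (l - c i v) < e].
  apply: complex_cauchy => e e0.
  have [|v Fv] := Fe (e / (`|C| + 1)); first by rewrite divr_gt0.
  exists (c i v); apply: filterS Fv => w /= vw.
  rewrite -cB (le_lt_trans (cC _ _))//.
  rewrite (le_lt_trans (ler_wpM2r (rnorm_ge0 _) (ler_norm C)))//.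
  rewrite ltr_pdivlMr// in vw; apply: le_lt_trans vw.
  by rewrite mulrC ler_wpM2l ?rnorm_ge0// lerDl.
have [x hx] := choice pt.
have Fx (e : R) : 0 < e -> F [set v | forall i, normc (x i - c i v) < e].
  by move=> e0; apply: filter_forall => i; exact: hx.
have [v hv] : exists v, forall i, c i v = x i.
  by apply: cl => e e0; have [v] := filter_ex (Fx _ e0); exists v.
apply/cvg_ex; exists v; apply: cvg_rnorm => e e0.
pose k : R := (`|D| + 1) * (#|I|%:R + 1).
have k0 : 0 < k by rewrite mulr_gt0 ?ltr_wpDl.
have ek : 0 < e / k by rewrite divr_gt0.
apply: filterS (Fx _ ek) => w /= hw.
have hs : \sum_i normc (c i (v - w)) <= #|I|%:R * (e / k).
  rewrite mulr_natl -sumr_const; apply: ler_sum => i _.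
  by rewrite cB hv ltW.
have s0 : 0 <= \sum_i normc (c i (v - w)).
  by apply: sumr_ge0 => i _; exact: normc_ge0.
rewrite (le_lt_trans (cD _))//.
rewrite (le_lt_trans (ler_wpM2r s0 (ler_norm D)))//.
rewrite (le_lt_trans (ler_wpM2l (normr_ge0 D) hs))//.
rewrite !mulrA ltr_pdivrMr// [_ * e]mulrC ltr_pM2l// /k.
have n0 : 0 <= #|I|%:R :> R by [].
have D0 : 0 <= `|D| by []; nra.
Qed.

End FiniteDimensionalCompleteness.

Notation ell1 R gT := {ffun gT -> R[i]}.

Definition lp_norm (R : realType) (gT : finGroupType) (p : R) (f : ell1 R gT)
  : R := (\sum_g normc (f g) `^ p) `^ p^-1.

Definition convolution {R : realType} {gT : finGroupType} (a b : ell1 R gT)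
  : ell1 R gT := [ffun g => \sum_h a h * b (h^-1 * g)%g].

(* The hypothesis 1 <= p is part of the type because the triangle inequality
   for lp_norm depends on it. *)
Definition ellp (R : realType) (gT : finGroupType) (p : R) (p1 : 1 <= p)
  : Type := ell1 R gT.

Section Minkowski.
Variables (R : realType) (gT : finGroupType) (p : R).
Hypothesis p1 : 1 <= p.
Implicit Types f g : ell1 R gT.

Let p0 : 0 < p. Proof. exact: lt_le_trans p1. Qed.
Let pn0 : p != 0. Proof. by rewrite gt_eqF. Qed.

Lemma lp_norm_ge0 f : 0 <= lp_norm p f.
Proof. exact: powR_ge0. Qed.

Lemma lp_sum_ge0 f : 0 <= \sum_x normc (f x) `^ p.
Proof. by apply: sumr_ge0 => x _; exact: powR_ge0. Qed.

Lemma lp_norm_pow f : lp_norm p f `^ p = \sum_x normc (f x) `^ p.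
Proof. by rewrite /lp_norm -powRrM mulVf// powRr1// lp_sum_ge0. Qed.

Lemma lp_norm_leP f (M : R) : 0 <= M ->
  \sum_x normc (f x) `^ p <= M `^ p -> lp_norm p f <= M.
Proof.
move=> M0 h; rewrite -[M]powRr1// -[X in _ `^ X](mulfV pn0) powRrM.
by apply: ge0_ler_powR => //; rewrite ?nnegrE ?invr_ge0 ?(ltW p0)//
  ?lp_sum_ge0 ?powR_ge0.
Qed.

Lemma lp_norm_coord f x : normc (f x) <= lp_norm p f.
Proof.
have : normc (f x) `^ p <= \sum_y normc (f y) `^ p.
  by rewrite (bigD1 x)//= lerDl sumr_ge0// => y _; exact: powR_ge0.
move=> h; have := @ge0_ler_powR R p^-1 _ _ _ _ _ h.
rewrite -powRrM mulfV// powRr1 ?normc_ge0//; apply;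
  by rewrite ?nnegrE ?invr_ge0 ?(ltW p0)// ?lp_sum_ge0 ?powR_ge0.
Qed.

Lemma lp_norm0_eq0 f : lp_norm p f = 0 -> f = 0.
Proof.
move=> f0; apply/ffunP => x; rewrite ffunE; apply: eq0_normc; apply/eqP.
by rewrite eq_le normc_ge0 andbT -f0 lp_norm_coord.
Qed.

Lemma lp_normZ (c : R[i]) f : lp_norm p (c *: f) = normc c * lp_norm p f.
Proof.
rewrite /lp_norm; under eq_bigr do rewrite ffunE normcM powRM ?normc_ge0//.
rewrite -mulr_sumr powRM ?powR_ge0 ?lp_sum_ge0//.
by rewrite -powRrM mulfV// powRr1// normc_ge0.
Qed.

Lemma powR_convex (t x y : R) : 0 <= t <= 1 -> 0 <= x -> 0 <= y ->
  (t * x + (1 - t) * y) `^ p <= t * x `^ p + (1 - t) * y `^ p.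
Proof.
move=> /andP[t0 t1] x0 y0.
have := @convex_powR R p p1 (Itv01 t0 t1) x y; rewrite !convRE/=; apply;
  by rewrite inE/= in_itv/= andbT.
Qed.

Lemma lp_normD f g : lp_norm p (f + g) <= lp_norm p f + lp_norm p g.
Proof.
have [f0|f0] := eqVneq (lp_norm p f) 0.
  by rewrite (lp_norm0_eq0 f0) add0r lerDr lp_norm_ge0.
have [g0|g0] := eqVneq (lp_norm p g) 0.
  by rewrite (lp_norm0_eq0 g0) addr0 lerDl lp_norm_ge0.
have := lp_norm_pow f; have := lp_norm_pow g.
have : 0 < lp_norm p f by rewrite lt_def f0 lp_norm_ge0.
have : 0 < lp_norm p g by rewrite lt_def g0 lp_norm_ge0.
move: (lp_norm p f) (lp_norm p g) => al be be0 al0 hbe hal.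
have ab0 : 0 < al + be by rewrite addr_gt0.
apply: lp_norm_leP; first exact: ltW.
pose t := al / (al + be).
have t01 : 0 <= t <= 1.
  apply/andP; split; first by apply: divr_ge0; apply: ltW.
  by rewrite /t ler_pdivrMr// mul1r lerDl ltW.
have t1E : 1 - t = be / (al + be).
  by apply/eqP; rewrite subr_eq -mulrDl addrC divff// gt_eqF.
pose B x := (al + be) `^ p *
  (t * (normc (f x) `^ p / al `^ p) + (1 - t) * (normc (g x) `^ p / be `^ p)).
have hB x : normc ((f + g) x) `^ p <= B x.
  rewrite ffunE (@le_trans _ _ ((normc (f x) + normc (g x)) `^ p))//.
    by apply: ge0_ler_powR; rewrite ?nnegrE ?addr_ge0 ?normc_ge0 ?(ltW p0)//
      normcD.
  have -> : normc (f x) + normc (g x) =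
      (al + be) * (t * (normc (f x) / al) + (1 - t) * (normc (g x) / be)).
    rewrite t1E /t; field.
    by rewrite !gt_eqF.
  have fx0 : 0 <= normc (f x) / al by rewrite divr_ge0 ?normc_ge0// ltW.
  have gx0 : 0 <= normc (g x) / be by rewrite divr_ge0 ?normc_ge0// ltW.
  have /andP[t0 t1] := t01.
  rewrite powRM ?(ltW ab0)//; last first.
    by rewrite addr_ge0// mulr_ge0// subr_ge0.
  rewrite /B ler_wpM2l ?powR_ge0//.
  have dE (z w : R) : 0 <= z -> 0 < w -> z `^ p / w `^ p = (z / w) `^ p.
    move=> z0 w0; rewrite powRM ?invr_ge0 ?(ltW w0)//; congr (_ * _).
    by rewrite -[w^-1]powR_inv1 ?(ltW w0)// -powRrM mulN1r powRN.
  by rewrite !dE ?normc_ge0//; exact: powR_convex.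
apply: (@le_trans _ _ (\sum_x B x)); first exact: ler_sum.
rewrite -mulr_sumr big_split/= -!mulr_sumr -!mulr_suml -hal -hbe.
by rewrite !divff ?gt_eqF ?powR_gt0// !mulr1 addrC subrK mulr1.
Qed.

Lemma lp_norm_shift f (h : gT) :
  lp_norm p [ffun x => f (h^-1 * x)%g] = lp_norm p f.
Proof.
rewrite /lp_norm; congr (_ `^ _).
rewrite [RHS](reindex_inj (mulgI h^-1%g))/=.
by apply: eq_bigr => x _; rewrite ffunE.
Qed.

End Minkowski.

Section Lambda.
Variables (R : realType) (gT : finGroupType) (p : R) (p1 : 1 <= p).
Local Notation l1 := (ell1 R gT).
Local Notation lp := (ellp gT p1).

HB.instance Definition _ := GRing.Lmodule.copy lp l1.

Lemma ellp_normD (f g : lp) :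
  (lp_norm p (f + g))%:C <= (lp_norm p f)%:C + (lp_norm p g)%:C.
Proof. by rewrite -rmorphD/= lecR lp_normD. Qed.

Lemma ellp_normZ (c : R[i]) (f : lp) :
  (lp_norm p (c *: f))%:C = `|c| * (lp_norm p f)%:C.
Proof. by rewrite lp_normZ// rmorphM/= normcE. Qed.

Lemma ellp_norm0_eq0 (f : lp) : (lp_norm p f)%:C = 0 -> f = 0.
Proof. by move=> [/(lp_norm0_eq0 p1)]. Qed.

HB.instance Definition _ := Lmodule_isNormed.Build R[i] lp
  ellp_normD ellp_normZ ellp_norm0_eq0.

Lemma rnorm_ellp (f : lp) : rnorm f = lp_norm p f.
Proof. by []. Qed.

Definition lambda (a : l1) : lp -> lp := fun b => convolution a b.

(* The norm of the reduced group L^p-operator algebra, which is also that of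
   the full one because the group is finite. *)
Definition Fp_norm (a : l1) : R := opnorm (lambda a).

Implicit Types a b c : l1.

Lemma conv_linearr a : linear (convolution a).
Proof.
move=> c f g; apply/ffunP => x; rewrite !ffunE scaler_sumr -big_split/=.
by apply: eq_bigr => h _; rewrite !ffunE mulrDr; congr (_ + _); exact: mulrCA.
Qed.

Lemma conv_linearl b : linear (convolution^~ b).
Proof.
move=> c f g; apply/ffunP => x; rewrite !ffunE scaler_sumr -big_split/=.
by apply: eq_bigr => h _; rewrite !ffunE mulrDl; congr (_ + _);
  exact/esym/mulrA.
Qed.

Lemma convA : associative (convolution : l1 -> l1 -> l1).
Proof.
move=> a b c; apply/ffunP => x; rewrite !ffunE.
under eq_bigr => h _.
  rewrite ffunE mulr_sumr (reindex_inj (mulgI h^-1%g))/=.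
  under eq_bigr => k _ do rewrite mulrA invMg invgK -mulgA mulKVg.
  over.
rewrite exchange_big/=; apply: eq_bigr => k _.
by rewrite ffunE mulr_suml.
Qed.

Definition delta1 : l1 := [ffun g => (g == 1%g)%:R].

Lemma conv_delta1 a : convolution a delta1 = a.
Proof.
apply/ffunP => x; rewrite ffunE (bigD1 x)//= ffunE mulVg eqxx mulr1.
rewrite big1 ?addr0// => h hx; rewrite ffunE -eq_mulVg1.
by rewrite (negbTE hx) mulr0.
Qed.

Lemma lambda_le a (b : lp) :
  rnorm (lambda a b) <= (\sum_h normc (a h)) * rnorm b.
Proof.
have -> : lambda a b =
    \sum_h a h *: ([ffun x => b (h^-1 * x)%g] : lp).
  apply/ffunP => x; rewrite ffunE.
  by rewrite sum_ffunE; apply: eq_bigr => h _; rewrite !ffunE.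
rewrite (le_trans (rnorm_sum _ _))// mulr_suml; apply: ler_sum => h _.
by rewrite rnormZ !rnorm_ellp lp_norm_shift.
Qed.

Lemma lambda_bounded a : bounded_op (lambda a).
Proof.
split; first exact: conv_linearr.
by exists (\sum_h normc (a h)) => v; exact: lambda_le.
Qed.

Lemma Fp_norm_ge0 a : 0 <= Fp_norm a.
Proof. exact: (opnorm_ge0 (lambda_bounded a)). Qed.

Lemma Fp_normD a b : Fp_norm (a + b) <= Fp_norm a + Fp_norm b.
Proof.
apply: le_trans (opnormD (lambda_bounded a) (lambda_bounded b)).
rewrite le_eqVlt; apply/orP; left; apply/eqP; rewrite /Fp_norm; congr opnorm.
apply/funext => f; exact: (linearopD (conv_linearl f)).
Qed.

Lemma Fp_normZ (c : R[i]) a : Fp_norm (c *: a) = normc c * Fp_norm a.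
Proof.
rewrite -(opnormZ c (lambda_bounded a)); congr opnorm.
apply/funext => f; exact: (linearopZ (conv_linearl f)).
Qed.

Lemma Fp_norm_coord a x : normc (a x) <= Fp_norm a.
Proof.
rewrite (le_trans (lp_norm_coord p1 a x))//.
have := opnorm_le (lambda_bounded a) (delta1 : lp).
rewrite !rnorm_ellp /lambda conv_delta1 => /le_trans; apply.
rewrite ler_piMr ?Fp_norm_ge0// /lp_norm (bigD1 1%g)//= ffunE eqxx.
rewrite normc1 powR1 big1 ?addr0 ?powR1// => y yn1.
by rewrite ffunE (negbTE yn1) normc0 powR0// gt_eqF// (lt_le_trans _ p1).
Qed.

Lemma Fp_norm_le a : Fp_norm a <= \sum_h normc (a h).
Proof.
apply: opnorm_lub => [|v]; last exact: lambda_le.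
by apply: sumr_ge0 => h _; exact: normc_ge0.
Qed.

Lemma Fp_norm_conv a b : Fp_norm (convolution a b) <= Fp_norm a * Fp_norm b.
Proof.
apply: le_trans (opnorm_comp (lambda_bounded a) (lambda_bounded b)).
rewrite le_eqVlt; apply/orP; left; apply/eqP; rewrite /Fp_norm; congr opnorm.
by apply/funext => f /=; rewrite /lambda convA.
Qed.

End Lambda.

Definition sum_zero (R : realType) (gT : finGroupType) : {pred ell1 R gT} :=
  fun a => \sum_g a g == 0.

Record ell01 (R : realType) (gT : finGroupType) := Ell01 {
  ell01_val :> ell1 R gT;
  _ : ell01_val \in @sum_zero R gT }.

Section Ell01.
Variables (R : realType) (gT : finGroupType).
Implicit Types (a b : ell01 R gT) (f : ell1 R gT).

HB.instance Definition _ := [isSub for @ell01_val R gT].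
HB.instance Definition _ := [Choice of ell01 R gT by <:].

Lemma sum_zeroP f : reflect (\sum_g f g = 0) (f \in @sum_zero R gT).
Proof. exact: eqP. Qed.

Lemma sum_zero_submod : submod_closed (@sum_zero R gT).
Proof.
split; first by apply/sum_zeroP; rewrite big1// => g _; rewrite ffunE.
move=> c f h /sum_zeroP f0 /sum_zeroP h0; apply/sum_zeroP.
under eq_bigr do rewrite !ffunE.
by rewrite big_split/= h0 addr0 -scaler_sumr f0 scaler0.
Qed.

HB.instance Definition _ :=
  GRing.isSubmodClosed.Build _ _ (@sum_zero R gT) sum_zero_submod.
HB.instance Definition _ := [SubChoice_isSubLmodule of ell01 R gT by <:].

Lemma ell01_sum a : \sum_g a g = 0.
Proof. by case: a => f /= /sum_zeroP. Qed.

Lemma sum_conv (f h : ell1 R gT) :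
  \sum_g convolution f h g = (\sum_g f g) * (\sum_g h g).
Proof.
under eq_bigr do rewrite ffunE.
rewrite exchange_big/= mulr_suml; apply: eq_bigr => k _.
rewrite -mulr_sumr; congr (_ * _).
by rewrite [RHS](reindex_inj (mulgI k^-1%g)).
Qed.

Lemma conv01_subproof a b : convolution a b \in @sum_zero R gT.
Proof. by apply/sum_zeroP; rewrite sum_conv ell01_sum mul0r. Qed.

Definition conv01 a b : ell01 R gT := Ell01 (conv01_subproof a b).

Lemma conv01A : associative conv01.
Proof. by move=> a b c; apply: val_inj; rewrite /= convA. Qed.

Lemma conv01_linearl b : linear (conv01^~ b).
Proof. by move=> c u v; apply: val_inj; exact: (conv_linearl b c u v). Qed.

Lemma conv01_linearr a : linear (conv01 a).
Proof. by move=> c u v; apply: val_inj; exact: (conv_linearr a c u v). Qed.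

Lemma unit01_subproof :
  [ffun g : gT => (g == 1%g)%:R - (#|gT|%:R)^-1] \in @sum_zero R gT.
Proof.
apply/sum_zeroP; under eq_bigr do rewrite ffunE.
rewrite sumrB (bigD1 1%g)//= eqxx big1 ?addr0 => [|g /negbTE ->//].
rewrite sumr_const -[X in _ - X]mulr_natl mulfV ?subrr//.
by rewrite pnatr_eq0 -lt0n; apply/card_gt0P; exists 1%g.
Qed.

Definition unit01 : ell01 R gT := Ell01 unit01_subproof.

Lemma conv01_unit a : conv01 a unit01 = a.
Proof.
apply: val_inj => /=; rewrite -[RHS]conv_delta1; apply/ffunP => x.
rewrite !ffunE; under eq_bigr do rewrite ffunE mulrBr.
rewrite sumrB -mulr_suml ell01_sum mul0r subr0.
by apply: eq_bigr => g _; rewrite ffunE.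
Qed.

Lemma ell01_coord_closed (x : gT -> R[i]) :
  (forall e : R, 0 < e -> exists a, forall g, normc (x g - a g) < e) ->
  exists a, forall g, a g = x g.
Proof.
move=> h; have xP : [ffun g => x g] \in @sum_zero R gT.
  apply/sum_zeroP/eq0_normc/eqP; rewrite eq_le normc_ge0 andbT.
  apply/ler_addgt0Pr => e e0; rewrite add0r.
  have n0 : 0 < (#|gT|%:R : R).
    by rewrite ltr0n; apply/card_gt0P; exists 1%g.
  have [|a ha] := h (e / #|gT|%:R); first by rewrite divr_gt0.
  have -> : \sum_g [ffun g => x g] g = \sum_g (x g - a g).
    by rewrite sumrB ell01_sum subr0; apply: eq_bigr => g _; rewrite ffunE.
  rewrite (le_trans (normc_sum _))//.
  apply: (@le_trans _ _ (\sum_(g : gT) e / #|gT|%:R)).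
    by apply: ler_sum => g _; rewrite ltW.
  by rewrite sumr_const -[X in X <= _]mulr_natr divfK// gt_eqF.
by exists (Ell01 xP) => g; rewrite /= ffunE.
Qed.

End Ell01.

(* ell01 with the convolution product and the norm Fp_norm. *)
Definition F0 (R : realType) (gT : finGroupType) (p : R) (p1 : 1 <= p)
  : Type := ell01 R gT.

Section F0.
Variables (R : realType) (gT : finGroupType) (p : R) (p1 : 1 <= p).
Local Notation F0p := (F0 gT p1).

HB.instance Definition _ := GRing.Lmodule.copy F0p (ell01 R gT).

Lemma F0_normD (a b : F0p) :
  (Fp_norm p1 (ell01_val (a + b)))%:C <=
  (Fp_norm p1 (ell01_val a))%:C + (Fp_norm p1 (ell01_val b))%:C.
Proof. by rewrite -rmorphD/= lecR; exact: Fp_normD. Qed.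

Lemma F0_normZ (c : R[i]) (a : F0p) :
  (Fp_norm p1 (ell01_val (c *: a)))%:C =
  `|c| * (Fp_norm p1 (ell01_val a))%:C.
Proof. by rewrite normcE -rmorphM/=; congr (_%:C); exact: Fp_normZ. Qed.

Lemma F0_norm0_eq0 (a : F0p) : (Fp_norm p1 (ell01_val a))%:C = 0 -> a = 0.
Proof.
move=> [a0]; apply: val_inj; apply/ffunP => g; rewrite [RHS]ffunE.
apply: eq0_normc; apply/eqP; rewrite eq_le normc_ge0 andbT -a0.
exact: Fp_norm_coord.
Qed.

HB.instance Definition _ := Lmodule_isNormed.Build R[i] F0p
  F0_normD F0_normZ F0_norm0_eq0.

Lemma rnorm_F0 (a : F0p) : rnorm a = Fp_norm p1 (ell01_val a).
Proof. by []. Qed.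

Lemma F0_complete (F : set_system F0p) : ProperFilter F -> cauchy F -> cvg F.
Proof.
apply: (@coord_complete R gT F0p (fun g a => ell01_val a g) 1 1)
  => [g u v|g v|v|].
- by rewrite /= !ffunE.
- by rewrite mul1r rnorm_F0; exact: Fp_norm_coord.
- by rewrite mul1r rnorm_F0; exact: Fp_norm_le.
- exact: ell01_coord_closed.
Qed.

HB.instance Definition _ := Uniform_isComplete.Build F0p F0_complete.

Lemma F0_conv_norm (a b : F0p) : `|conv01 a b : F0p| <= `|a| * `|b|.
Proof. by rewrite -!rnormE -rmorphM/= lecR; exact: Fp_norm_conv. Qed.

HB.instance Definition _ := isBanachAlgebra.Build R F0p
  (@conv01A R gT) (@conv01_linearl R gT) (@conv01_linearr R gT) F0_conv_norm.

End F0.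

Definition left_mul (R : realType) (gT : finGroupType) (p : R) (p1 : 1 <= p)
    (a : ell01 R gT) : F0 gT p1 -> F0 gT p1 := fun b => conv01 a b.
Arguments left_mul {R gT p} p1 a b.

Definition left_mul_norm (R : realType) (gT : finGroupType) (p : R)
    (p1 : 1 <= p) (a : ell01 R gT) : R := opnorm (left_mul p1 a).

(* ell01 with the convolution product and the norm left_mul_norm. *)
Definition ell01_mul (R : realType) (gT : finGroupType) (p : R) (p1 : 1 <= p)
  : Type := ell01 R gT.

Section Ell01Mul.
Variables (R : realType) (gT : finGroupType) (p : R) (p1 : 1 <= p).
Local Notation F0p := (F0 gT p1).
Local Notation B := (ell01_mul gT p1).

HB.instance Definition _ := GRing.Lmodule.copy B (ell01 R gT).

Lemma left_mul_bounded (a : ell01 R gT) : bounded_op (left_mul p1 a).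
Proof.
split; first exact: (conv01_linearr a).
by exists (rnorm (a : F0p)) => b; exact: Fp_norm_conv.
Qed.

Lemma ell01_mul_normD (a b : B) :
  (left_mul_norm p1 (a + b))%:C <=
  (left_mul_norm p1 a)%:C + (left_mul_norm p1 b)%:C.
Proof.
rewrite -rmorphD/= lecR.
apply: le_trans (opnormD (left_mul_bounded a) (left_mul_bounded b)).
rewrite le_eqVlt; apply/orP; left; apply/eqP; congr opnorm.
by apply/funext => f; exact: (linearopD (conv01_linearl f)).
Qed.

Lemma ell01_mul_normZ (c : R[i]) (a : B) :
  (left_mul_norm p1 (c *: a))%:C = `|c| * (left_mul_norm p1 a)%:C.
Proof.
rewrite normcE -rmorphM/=; congr (_%:C).
rewrite -(opnormZ c (left_mul_bounded a)); congr opnorm.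
by apply/funext => f; exact: (linearopZ (conv01_linearl f)).
Qed.

Lemma F0_le_left_mul (a : ell01 R gT) :
  rnorm (a : F0p) <= left_mul_norm p1 a * rnorm (unit01 R gT : F0p).
Proof.
have := opnorm_le (left_mul_bounded a) (unit01 R gT : F0p).
by rewrite /left_mul conv01_unit.
Qed.

Lemma ell01_mul_norm0_eq0 (a : B) : (left_mul_norm p1 a)%:C = 0 -> a = 0.
Proof.
move=> [a0]; apply: (@rnorm0_eq0 _ F0p); apply/eqP.
by rewrite eq_le rnorm_ge0 andbT; have := F0_le_left_mul a; rewrite a0 mul0r.
Qed.

HB.instance Definition _ := Lmodule_isNormed.Build R[i] B
  ell01_mul_normD ell01_mul_normZ ell01_mul_norm0_eq0.

Lemma rnorm_ell01_mul (a : B) : rnorm a = left_mul_norm p1 a.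
Proof. by []. Qed.

Lemma ell01_mul_complete (F : set_system B) :
  ProperFilter F -> cauchy F -> cvg F.
Proof.
apply: (@coord_complete R gT B (fun g a => ell01_val a g)
  (rnorm (unit01 R gT : F0p)) 1) => [g u v|g v|v|].
- by rewrite /= !ffunE.
- rewrite rnorm_ell01_mul mulrC (le_trans (Fp_norm_coord p1 _ g))//.
  exact: F0_le_left_mul.
- rewrite mul1r rnorm_ell01_mul (le_trans _ (Fp_norm_le p1 _))//.
  apply: opnorm_lub => [|b]; first exact: Fp_norm_ge0.
  exact: Fp_norm_conv.
- exact: ell01_coord_closed.
Qed.

HB.instance Definition _ := Uniform_isComplete.Build B ell01_mul_complete.

Lemma ell01_mul_conv_norm (a b : B) : `|conv01 a b : B| <= `|a| * `|b|.
Proof.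
rewrite -!rnormE -rmorphM/= lecR !rnorm_ell01_mul.
apply: le_trans (opnorm_comp (left_mul_bounded a) (left_mul_bounded b)).
rewrite le_eqVlt; apply/orP; left; apply/eqP; congr opnorm.
by apply/funext => f; rewrite /left_mul /= conv01A.
Qed.

HB.instance Definition _ := isBanachAlgebra.Build R B
  (@conv01A R gT) (@conv01_linearl R gT) (@conv01_linearr R gT)
  ell01_mul_conv_norm.

End Ell01Mul.

(* Main.v *)
(* The algebra F_0^p(G) is commutative with unit u = delta_1 - 1/|G|, so a
   multiplier (L, R) satisfies L v = L (u v) = L(u) v and
   R v = (R v) u = v L(u).  Hence (L, R) |-> L(u) inverts
   a |-> (left_mul a, left_mul a). *)
Require Import Defs.
From mathcomp Require Import all_boot all_order all_algebra all_fingroup.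
From mathcomp Require Import complex.
From mathcomp Require Import all_classical all_reals all_analysis.

Set Implicit Arguments.
Unset Strict Implicit.
Unset Printing Implicit Defensive.

Import Order.TTheory GRing.Theory Num.Theory.
Import numFieldNormedType.Exports.

Local Open Scope classical_set_scope.
Local Open Scope ring_scope.
Local Open Scope complex_scope.

Lemma multL_unit (R : realType) (A : banachAlgType R) (u : A)
    (m : multiplier A) v : left_id u bmul -> multL m v = multL m u ** v.
Proof. by move=> mulu; have [_ _ mL _ _] := multiplierP m; rewrite -mL mulu. Qed.

Lemma multR_unit (R : realType) (A : banachAlgType R) (u : A)
    (m : multiplier A) v : right_id u bmul -> multR m v = v ** multL m u.
Proof.
by move=> mulu; have [_ _ _ _ mLR] := multiplierP m; rewrite mLR mulu.
Qed.

Lemma convC (R : realType) (gT : finGroupType) :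
  abelian [set: gT]%SET -> commutative (@convolution R gT).
Proof.
move=> /centsP abelG a b; apply/ffunP => x; rewrite !ffunE.
(* The substitution [h -> x * h^-1] turns the summand into [a (x * h^-1) * b h]; commutativity of
   the group then gives [h^-1 * x]. *)
rewrite (reindex_inj (inj_comp (mulgI x) invg_inj))/=.
apply: eq_bigr => h _; rewrite invMg invgK mulgKV mulrC.
by rewrite (abelG x _ h^-1%g) ?inE.
Qed.

(** Bridges [opnorm], a supremum over the closed unit ball, and the supremum over the unit sphere
    used for [|||a|||_p]: by homogeneity a nonzero vector can be rescaled to norm one. *)
Lemma opnorm_sphere (R : realType) (V W : normedModType R[i]) (T : V -> W) :
  bounded_op T ->
  opnorm T = sup [set rnorm (T v) | v in [set v | rnorm v = 1]].
Proof.
move=> bT; have ub : has_ubound [set rnorm (T v) | v in [set v | rnorm v = 1]].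
  by exists (opnorm T) => _ [v /= v1 <-]; rewrite opnorm_ub// v1.
have le_sup v : rnorm v != 0 ->
    rnorm (T v) <=
      sup [set rnorm (T v) | v in [set v | rnorm v = 1]] * rnorm v.
  move=> v0; have vp : 0 < rnorm v by rewrite lt_def v0 rnorm_ge0.
  have nI : Normc.normc ((rnorm v)^-1)%:C = (rnorm v)^-1.
    by rewrite normc_real// invr_ge0 ltW.
  rewrite -ler_pdivrMr// mulrC -nI -rnormZ -(linearopZ bT.1).
  apply: ub_le_sup => //; exists (((rnorm v)^-1)%:C *: v) => //=.
  by rewrite rnormZ nI mulVf.
apply/eqP; rewrite eq_le; apply/andP; split.
  apply: opnorm_lub => [|v].
    (* The sphere is empty when [V] is zero, as for [F0] of the trivial group; then [sup set0 = 0]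
       is still the right value. *)
    have [->|/set0P[r Sr]] :=
        eqVneq [set rnorm (T v) | v in [set v | rnorm v = 1]] set0.
      by rewrite sup0.
    apply: le_trans (ub_le_sup ub Sr).
    by case: Sr => v _ <-; exact: rnorm_ge0.
  have [v0|/le_sup//] := eqVneq (rnorm v) 0.
  by rewrite v0 mulr0 (rnorm0_eq0 v0) (linearop0 bT.1) rnorm0.
have [->|/set0P S0] :=
    eqVneq [set rnorm (T v) | v in [set v | rnorm v = 1]] set0.
  by rewrite sup0 opnorm_ge0.
by apply: ge_sup => // _ [v /= v1 <-]; rewrite opnorm_ub// v1.
Qed.

Theorem proposition4p18 (R : realType) (gT : finGroupType)
    (abelG : abelian [set: gT]%SET) (p : R) (p1 : (1 <= p)%R) :
  isometrically_isomorphic (multiplier (F0 gT p1)) (ell01_mul gT p1) /\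
  (forall a : ell01 R gT,
     rnorm (a : ell01_mul gT p1) = opnorm (left_mul p1 a) /\
     opnorm (left_mul p1 a) =
       sup [set Fp_norm p1 (convolution a b)
             | b in [set b : ell01 R gT | Fp_norm p1 b = 1]]).
Proof.
have mulC (a b : F0 gT p1) : a ** b = b ** a.
  by apply: val_inj; exact: convC.
have mulu : right_id (unit01 R gT : F0 gT p1) bmul by exact: conv01_unit.
have umul : left_id (unit01 R gT : F0 gT p1) bmul.
  by move=> a; rewrite mulC mulu.
split; last first.
  move=> a; split; first exact: rnorm_ell01_mul.
  (* The norm of [F0] unfolds to [Fp_norm], so both suprema agree by conversion. *)
  exact: opnorm_sphere (left_mul_bounded p1 a).
have multLE (m : multiplier (F0 gT p1)) :
    multL m = left_mul p1 (multL m (unit01 R gT)).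
  by apply/funext => v; exact: multL_unit.
have multRE (m : multiplier (F0 gT p1)) : multR m = multL m.
  by apply/funext => v; rewrite (multR_unit m v mulu) mulC -multL_unit.
exists (fun m : multiplier (F0 gT p1) => multL m (unit01 R gT)); split.
(* Multipliers are added and scaled pointwise, so evaluation at the unit is linear by
   computation. *)
- by move=> c m m'.
- have mulP (a : F0 gT p1) :
      (left_mul p1 a, left_mul p1 a) \in @multiplier_pred R (F0 gT p1).
    (* The left identity is associativity; the other two, [a(bc) = b(ac)] and [b(ac) = (ab)c], also
       need commutativity. *)
    apply/asboolP; split=> /= [||b c|b c|b c]; try exact: left_mul_bounded.
    + exact: bmulA.
    + by rewrite -![left_mul _ _ _]/(a ** _) !bmulA (mulC a b).
    + by rewrite -![left_mul _ _ _]/(a ** _) bmulA (mulC b a).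
  exists (fun a => Multiplier (mulP a)) => [m|a]; last exact: conv01_unit.
  apply: multiplier_ext => v; first by rewrite [in RHS]multLE.
  by rewrite [in RHS]multRE [in RHS]multLE.
- move=> m m'; rewrite -[LHS]/(multL m (multL m' (unit01 R gT))).
  by rewrite [in LHS](multLE m).
- move=> m; rewrite -rnormE -(rnormE m) rnorm_ell01_mul rnorm_mult.
  (* Both components coincide, so the maximum collapses to the norm of left multiplication by the
     image of [m]. *)
  by rewrite /mult_norm multRE maxxx [in RHS]multLE.
Qed.
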